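(* Let $\mathbf F$ be a Fraïssé structure whose automorphism group $\mathrm{Aut}(\mathbf F)$ is Roelcke-precompact. The following are equivalent: (i) Every minimal subflow of $\mathrm{Aut}(\mathbf F)\curvearrowright R(\mathrm{Aut}(\mathbf F))$ is trivial (i.e. reduced to a single point). (ii) $\mathrm{Age}(\mathbf F)$ has the definable Ramsey property.
   Context: Structures. Languages are first-order and relational; a structure is a non-empty set with interpretations of the relation symbols. An embedding is an isomorphism onto its image; $\binom{\mathbf B}{\mathbf A}$ denotes the set of all embeddings of $\mathbf A$ into $\mathbf B$. A Fraïssé structure is a countable ultrahomogeneous structure (every isomorphism between finite substructures extends to an automorphism). $\mathrm{Age}(\mathbf F)$ is the set of all finite substructures of $\mathbf F$ (considered up to isomorphism). $\mathrm{Aut}(\mathbf F)$ is a topological group for which the pointwise stabilizers of finite substructures form a basis of neighborhoods of the identity. Joint embeddings. Let $\mathcal K$ be a class of finite structures. A joint embedding $\langle a,z\rangle$ of $\mathbf A$ and $\mathbf Z$ is a pair of embeddings $a:\mathbf A\to\mathbf C$, $z:\mathbf Z\to\mathbf C$ into a common structure $\mathbf C$, isomorphic to a member of $\mathcal K$, with $C=a(A)\cup z(Z)$. When $a,z$ take values in a larger structure, $\langle a,z\rangle$ is understood with common range the substructure on $a(A)\cup z(Z)$. Two joint embeddings $\langle a,z\rangle$, $\langle a',z'\rangle$ with common ranges $\mathbf C,\mathbf C'$ are isomorphic when there is an isomorphism $c:\mathbf C\to\mathbf C'$ with $a'=c\circ a$, $z'=c\circ z$. The isomorphism type of $\langle a,z\rangle$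 is its joint embedding pattern $[a,z]$. Definable Ramsey property. $\mathcal K$ has the definable Ramsey property when for all $\mathbf A,\mathbf B,\mathbf Z\in\mathcal K$ there exists $\mathbf C\in\mathcal K$ such that for every joint embedding $\langle c,z\rangle$ of $\mathbf C$ and $\mathbf Z$ there is $b\in\binom{\mathbf C}{\mathbf B}$ such that the coloring $a\mapsto[c\circ a,z]$ is constant on $\binom{b(\mathbf B)}{\mathbf A}$. Roelcke compactification. For a topological group $G$, the Roelcke uniformity is the finest uniformity coarser than both the left uniformity (entourages $\{(g,h):g^{-1}h\in U\}$) and the right uniformity (entourages $\{(g,h):gh^{-1}\in U\}$), $U$ ranging over neighborhoods of the identity. $G$ is Roelcke-precompact when its completion for the Roelcke uniformity is compact. $\mathrm{Ro}_b(G)$ is the C$^*$-algebra (supremum norm) of bounded functions $G\to\mathbb C$ uniformly continuous for the Roelcke uniformity. $R(G)$ is its Gelfand space (the space of unital C$^*$-homomorphisms $\phi:\mathrm{Ro}_b(G)\to\mathbb C$ with the weak$^*$ topology), on which $G$ acts continuously by $(g\cdot\phi)(f)=\phi(g^{-1}\cdot f)$, where $(g\cdot f)(h)=f(g^{-1}h)$. A subflow is a non-empty closed invariant subset with the restricted action; it is minimal when it contains no proper subflow. *)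

(* Defs.v *)
From HB Require Import structures.
From mathcomp Require Import all_boot all_order all_algebra.
From mathcomp Require Import complex.
From mathcomp Require Import all_classical all_reals topology normedtype.

Set Implicit Arguments.
Unset Strict Implicit.
Unset Printing Implicit Defensive.

Import Order.TTheory GRing.Theory Num.Theory.
Import numFieldTopology.Exports numFieldNormedType.Exports.

Local Open Scope classical_set_scope.

Record language := Language { symbol :> Type; arity : symbol -> nat }.

Record structure (L : language) := Structure {
  carrier :> Type;
  carrier_neq0 : [set: carrier] !=set0;
  interp : forall r : L, set ('I_(arity r) -> carrier)
}.
Arguments interp {L s} r t.

Section Morphisms.
Context {L : language}.
Implicit Types A B C : structure L.

Record embedding A B := Embedding {
  emb_fun :> A -> B;
  emb_inj : injective emb_fun;
  emb_interp : forall (r : L) (t : 'I_(arity r) -> A),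
    interp r (emb_fun \o t) <-> interp r t
}.

Record isomorphism A B := Isomorphism {
  iso_emb :> embedding A B;
  iso_surj : forall y : B, exists x : A, iso_emb x = y
}.

Definition isomorphic A B : Prop := exists _ : isomorphism A B, True.

Lemma embedding_ext A B (f g : embedding A B) : f =1 g -> f = g.
Proof.
case: f g => [f fi fr] [g gi gr] /= /funext fg; move: fi fr gi gr.
by rewrite fg => *; congr Embedding; exact: Prop_irrelevance.
Qed.

Lemma isomorphism_ext A B (f g : isomorphism A B) : f =1 g -> f = g.
Proof.
case: f g => [f fs] [g gs] /= /embedding_ext fg; move: fs gs; rewrite fg => *.
by congr Isomorphism; exact: Prop_irrelevance.
Qed.

Lemma emb_id_interp A (r : L) (t : 'I_(arity r) -> A) :
  interp r (id \o t) <-> interp r t.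
Proof. by []. Qed.

Definition emb_id A : embedding A A := Embedding (@inj_id A) (@emb_id_interp A).

Lemma emb_comp_interp A B C (g : embedding B C) (f : embedding A B) (r : L)
  (t : 'I_(arity r) -> A) : interp r ((g \o f) \o t) <-> interp r t.
Proof. by rewrite -(emb_interp f t) -(emb_interp g (f \o t)). Qed.

Definition emb_comp A B C (g : embedding B C) (f : embedding A B) :
    embedding A C :=
  Embedding (inj_comp (@emb_inj _ _ g) (@emb_inj _ _ f))
    (@emb_comp_interp A B C g f).

Lemma iso_id_surj A (y : A) : exists x : A, emb_id A x = y.
Proof. by exists y. Qed.

Definition iso_id A : isomorphism A A := Isomorphism (@iso_id_surj A).

Lemma iso_comp_surj A B C (g : isomorphism B C) (f : isomorphism A B) (y : C) :
  exists x : A, emb_comp g f x = y.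
Proof.
by have [z <-] := iso_surj g y; have [x <-] := iso_surj f z; exists x.
Qed.

Definition iso_comp A B C (g : isomorphism B C) (f : isomorphism A B) :
  isomorphism A C := Isomorphism (@iso_comp_surj A B C g f).

Definition iso_inv_fun A B (f : isomorphism A B) (y : B) : A :=
  sval (cid (iso_surj f y)).

Lemma iso_invK A B (f : isomorphism A B) : cancel (iso_inv_fun f) f.
Proof. by move=> y; rewrite /iso_inv_fun; case: cid. Qed.

Lemma iso_funK A B (f : isomorphism A B) : cancel f (iso_inv_fun f).
Proof. by move=> x; apply: (@emb_inj _ _ f); rewrite iso_invK. Qed.

Lemma iso_inv_interp A B (f : isomorphism A B) (r : L) (t : 'I_(arity r) -> B) :
  interp r (iso_inv_fun f \o t) <-> interp r t.
Proof.
rewrite -(emb_interp f (iso_inv_fun f \o t)) compA.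
by rewrite (_ : f \o iso_inv_fun f = id) //; apply/funext/iso_invK.
Qed.

Definition iso_inv_emb A B (f : isomorphism A B) : embedding B A :=
  Embedding (can_inj (iso_invK f)) (@iso_inv_interp A B f).

Lemma iso_inv_surj A B (f : isomorphism A B) (x : A) :
  exists y : B, iso_inv_emb f y = x.
Proof. by exists (f x); exact: iso_funK. Qed.

Definition iso_inv A B (f : isomorphism A B) : isomorphism B A :=
  Isomorphism (@iso_inv_surj A B f).

Lemma induced_neq0 A (S : set A) : S !=set0 -> [set: {x : A | x \in S}] !=set0.
Proof. by case=> x Sx; exists (SigSub (mem_set Sx)). Qed.

(* As the language is relational, every non-empty subset carries a
   substructure. *)
Definition induced A (S : set A) (S0 : S !=set0) : structure L :=
  {| carrier := {x : A | x \in S};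
     carrier_neq0 := induced_neq0 S0;
     interp := fun r t => interp r (val \o t) |}.

Definition incl_fun A (S : set A) (S0 : S !=set0) (x : induced S0) : A :=
  sval x.

Lemma incl_inj A (S : set A) (S0 : S !=set0) : injective (@incl_fun A S S0).
Proof. exact: val_inj. Qed.

Lemma incl_interp A (S : set A) (S0 : S !=set0) (r : L)
    (t : 'I_(arity r) -> induced S0) :
  interp r (@incl_fun A S S0 \o t) <-> interp r t.
Proof. by []. Qed.

Definition incl A (S : set A) (S0 : S !=set0) : embedding (induced S0) A :=
  Embedding (@incl_inj A S S0) (@incl_interp A S S0).

Lemma range_neq0 A B (f : embedding A B) : range f !=set0.
Proof. by have [x _] := carrier_neq0 A; exists (f x); exists x. Qed.

Definition emb_image A B (f : embedding A B) : structure L :=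
  induced (range_neq0 f).

Definition ultrahomogeneous A : Prop :=
  forall (S T : set A) (S0 : S !=set0) (T0 : T !=set0),
    finite_set S -> finite_set T ->
    forall f : isomorphism (induced S0) (induced T0),
    exists g : isomorphism A A, forall x : induced S0, g (incl S0 x) = incl T0 (f x).

Definition fraisse A : Prop := countable [set: A] /\ ultrahomogeneous A.

(* Closed under isomorphism. *)
Definition age A : set (structure L) :=
  [set B | exists (S : set A) (S0 : S !=set0),
     finite_set S /\ isomorphic B (induced S0)].

End Morphisms.

Section JointEmbeddings.
Context {L : language}.
Implicit Types (K : set (structure L)) (A B C Z : structure L).

(* Membership of the common range in the ambient class is joint_in below. *)
Record joint_embedding A Z := JointEmbedding {
  joint_range : structure L;
  joint_l : embedding A joint_range;
  joint_r : embedding Z joint_range;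
  joint_cover : range joint_l `|` range joint_r = setT
}.

Definition joint_in K A Z (j : joint_embedding A Z) : Prop :=
  exists2 D, K D & isomorphic (joint_range j) D.

Definition joint_iso A Z (j j' : joint_embedding A Z) : Prop :=
  exists c : isomorphism (joint_range j) (joint_range j'),
    joint_l j' =1 c \o joint_l j /\ joint_r j' =1 c \o joint_r j.

(* An isomorphism type is represented by the class of all its members. *)
Definition pattern A Z (j : joint_embedding A Z) : set (joint_embedding A Z) :=
  [set j' | joint_iso j j'].

Section Span.
Context A Z C (a : embedding A C) (z : embedding Z C).

Definition span_set : set C := range a `|` range z.

Lemma span_neq0 : span_set !=set0.
Proof. by have [x ax] := range_neq0 a; exists x; left. Qed.

Definition span : structure L := induced span_neq0.

Definition span_l_fun (x : A) : span :=
  SigSub (mem_set (or_introl (imageT a x) : span_set (a x))).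

Definition span_r_fun (x : Z) : span :=
  SigSub (mem_set (or_intror (imageT z x) : span_set (z x))).

Lemma span_l_inj : injective span_l_fun.
Proof. by move=> x y /(congr1 val) /=; exact: emb_inj. Qed.

Lemma span_r_inj : injective span_r_fun.
Proof. by move=> x y /(congr1 val) /=; exact: emb_inj. Qed.

Lemma span_l_interp (r : L) (t : 'I_(arity r) -> A) :
  interp r (span_l_fun \o t) <-> interp r t.
Proof. exact: (emb_interp a t). Qed.

Lemma span_r_interp (r : L) (t : 'I_(arity r) -> Z) :
  interp r (span_r_fun \o t) <-> interp r t.
Proof. exact: (emb_interp z t). Qed.

Lemma span_cover : range span_l_fun `|` range span_r_fun = setT.
Proof.
apply/seteqP; split=> // -[y yS] _; have := set_mem yS.
by case=> -[x _ xy]; [left|right]; exists x => //; apply: val_inj.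
Qed.

Definition joint_span : joint_embedding A Z :=
  @JointEmbedding A Z span (Embedding span_l_inj span_l_interp)
    (Embedding span_r_inj span_r_interp) span_cover.

End Span.

Definition definable_ramsey K : Prop :=
  forall A B Z, K A -> K B -> K Z ->
  exists2 C, K C &
    forall j : joint_embedding C Z, joint_in K j ->
    exists b : embedding B C,
    forall a a' : embedding A (emb_image b),
      let color (x : embedding A (emb_image b)) :=
        pattern (joint_span
          (emb_comp (joint_l j) (emb_comp (incl (range_neq0 b)) x))
          (joint_r j)) in
      color a = color a'.

End JointEmbeddings.

HB.mixin Record isTopologicalGroup G & Group G & Topological G := {
  mulg_continuous : continuous (fun x : G * G => (x.1 * x.2)%g);
  invg_continuous : continuous (fun x : G => (x^-1)%g)
}.

#[short(type="topologicalGroupType")]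
HB.structure Definition TopologicalGroup :=
  {G of Group G & Topological G & isTopologicalGroup G}.

Definition Aut (L : language) (F : structure L) : Type := isomorphism F F.

Section AutomorphismGroup.
Context (L : language) (F : structure L).
Local Notation G := (Aut F).

HB.instance Definition _ := gen_eqMixin G.
HB.instance Definition _ := gen_choiceMixin G.

Let mul (g h : G) : G := iso_comp g h.
Let one : G := iso_id F.
Let inv (g : G) : G := iso_inv g.

Let mulA : associative mul.
Proof. by move=> f g h; apply: isomorphism_ext. Qed.
Let mul1 : left_id one mul.
Proof. by move=> f; apply: isomorphism_ext. Qed.
Let mulr1 : right_id one mul.
Proof. by move=> f; apply: isomorphism_ext. Qed.
Let mulV : left_inverse one inv mul.
Proof. by move=> f; apply: isomorphism_ext => x; exact: iso_funK. Qed.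
Let mulrV : right_inverse one inv mul.
Proof. by move=> f; apply: isomorphism_ext => x; exact: iso_invK. Qed.

HB.instance Definition _ := isGroup.Build G mulA mul1 mulr1 mulV mulrV.

Definition stabilizer (S : set F) : set G := [set g | forall x, S x -> g x = x].

(* The sets g * stabilizer S, S finite, form a basis of neighbourhoods of g. *)
Definition Aut_nbhs (g : G) : set_system G :=
  filter_from (@finite_set F) (fun S => [set h | stabilizer S (g^-1 * h)%g]).

HB.instance Definition _ := hasNbhs.Build G Aut_nbhs.

Lemma Aut_stabE (g h : G) (S : set F) :
  stabilizer S (g^-1 * h)%g <-> (forall x, S x -> h x = g x).
Proof.
split=> gh x Sx; first by rewrite -[in RHS](gh x Sx); rewrite [RHS]iso_invK.
by rewrite [LHS]/(iso_inv_fun g (h x)) gh//; exact: iso_funK.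
Qed.

Lemma Aut_nbhsP (g : G) (A : set G) : nbhs g A <->
  exists2 S : set F, finite_set S &
    forall h : G, (forall x, S x -> h x = g x) -> A h.
Proof.
by split=> -[S fS SA]; exists S => // h /Aut_stabE /SA.
Qed.

Let nbhs_filter (g : G) : ProperFilter (nbhs g).
Proof.
apply: Build_ProperFilter_ex.
  by move=> A /Aut_nbhsP[S _ SA]; exists g; exact: SA.
split.
- by apply/Aut_nbhsP; exists set0.
- move=> A B /Aut_nbhsP[S fS SA] /Aut_nbhsP[T fT TB]; apply/Aut_nbhsP.
  exists (S `|` T); first by rewrite finite_setU.
  by move=> h hg; split; [apply: SA|apply: TB] => x Sx; apply: hg; [left|right].
- move=> A B AB /Aut_nbhsP[S fS SA]; apply/Aut_nbhsP.
  by exists S => // h /SA /AB.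
Qed.

Let nbhs_singleton (g : G) (A : set G) : nbhs g A -> A g.
Proof. by move=> /Aut_nbhsP[S _ SA]; exact: SA. Qed.

Let nbhs_nbhs (g : G) (A : set G) : nbhs g A -> nbhs g (nbhs^~ A).
Proof.
move=> /Aut_nbhsP[S fS SA]; apply/Aut_nbhsP; exists S => // h hg.
apply/Aut_nbhsP; exists S => // k kh; apply: SA => x Sx.
by rewrite kh// hg.
Qed.

HB.instance Definition _ := Nbhs_isNbhsTopological.Build G
  nbhs_filter nbhs_singleton nbhs_nbhs.

Let mul_continuous : continuous (fun x : G * G => (x.1 * x.2)%g).
Proof.
move=> [g h] A /Aut_nbhsP[S fS SA].
exists ([set k : G | forall x, (h @` S) x -> k x = g x],
        [set k : G | forall x, S x -> k x = h x]).
  by split; apply/Aut_nbhsP; [exists (h @` S) => //; exact: finite_image|exists S].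
move=> [k l] /= [kg lh]; apply: SA => x Sx.
by rewrite -[LHS]/(k (l x)) lh// kg//; exists x.
Qed.

Let inv_continuous : continuous (fun x : G => (x^-1)%g).
Proof.
move=> g A /Aut_nbhsP[S fS SA]; apply/Aut_nbhsP.
exists (iso_inv_fun g @` S); first exact: finite_image.
move=> h hg; apply: SA => x Sx; apply: (@emb_inj _ _ _ h).
rewrite [LHS](iso_invK h x) -[RHS]/(h (iso_inv_fun g x)) hg; last by exists x.
by rewrite iso_invK.
Qed.

HB.instance Definition _ :=
  isTopologicalGroup.Build G mul_continuous inv_continuous.

End AutomorphismGroup.

Section Uniformities.
Local Open Scope relation_scope.

Definition uniformity T (E : set_system (T * T)) : Prop :=
  [/\ Filter E,
      forall A, E A -> diagonal `<=` A,
      forall A, E A -> E A^-1 &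
      forall A, E A -> exists2 B, E B & B \; B `<=` A].

Lemma uniformity_join T (E1 E2 : set_system (T * T)) :
  uniformity E1 -> uniformity E2 ->
  uniformity [set A | exists B1 B2, [/\ E1 B1, E2 B2 & B1 `&` B2 `<=` A]].
Proof.
move=> [F1 d1 i1 s1] [F2 d2 i2 s2]; split.
- split.
  + by exists setT, setT; split => //; exact: filterT.
  + move=> P Q [B1 [B2 [h1 h2 BP]]] [C1 [C2 [k1 k2 CQ]]].
    exists (B1 `&` C1), (B2 `&` C2); split; [exact: filterI|exact: filterI|].
    by move=> x [[? ?] [? ?]]; split; [apply: BP|apply: CQ].
  + move=> P Q PQ [B1 [B2 [h1 h2 BP]]]; exists B1, B2; split => //.
    exact: subset_trans PQ.
- move=> A [B1 [B2 [h1 h2 BA]]] x dx; apply: BA.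
  by split; [exact: d1 h1 _ dx|exact: d2 h2 _ dx].
- move=> A [B1 [B2 [h1 h2 BA]]]; exists (B1^-1), (B2^-1).
  by split; [exact: i1|exact: i2|move=> x [? ?]; apply: BA].
- move=> A [B1 [B2 [h1 h2 BA]]].
  have [C1 k1 CB1] := s1 _ h1; have [C2 k2 CB2] := s2 _ h2.
  exists (C1 `&` C2); first by exists C1, C2; split => //; exact: subset_refl.
  move=> [x y] [z [? ?] [? ?]]; apply: BA.
  by split; [apply: CB1|apply: CB2]; exists z.
Qed.

End Uniformities.

Section Roelcke.
Context (G : topologicalGroupType).

Definition left_entourage : set_system (G * G) :=
  filter_from (nbhs (1%g : G)) (fun U => [set gh | U (gh.1^-1 * gh.2)%g]).

Definition right_entourage : set_system (G * G) :=
  filter_from (nbhs (1%g : G)) (fun U => [set gh | U (gh.1 * gh.2^-1)%g]).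

Definition below_left_right (E : set_system (G * G)) : Prop :=
  E `<=` left_entourage /\ E `<=` right_entourage.

(* The finest uniformity coarser than both is the union of all of them: this
   union is directed by uniformity_join. *)
Definition roelcke_entourage : set_system (G * G) :=
  [set A | exists E, [/\ uniformity E, below_left_right E & E A]].

Lemma left_entourage_filter : Filter left_entourage.
Proof.
apply: filter_from_filter; first by exists setT; exact: filterT.
by move=> U V nU nV; exists (U `&` V) => //; exact: filterI.
Qed.

Lemma right_entourage_filter : Filter right_entourage.
Proof.
apply: filter_from_filter; first by exists setT; exact: filterT.
by move=> U V nU nV; exists (U `&` V) => //; exact: filterI.
Qed.

Lemma below_left_right_join (E1 E2 : set_system (G * G)) :
  below_left_right E1 -> below_left_right E2 ->
  below_left_right [set A | exists B1 B2, [/\ E1 B1, E2 B2 & B1 `&` B2 `<=` A]].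
Proof.
have FL := left_entourage_filter; have FR := right_entourage_filter.
move=> [l1 r1] [l2 r2]; split=> A [B1 [B2 [h1 h2 BA]]]; apply: filterS BA _.
  by apply: filterI; [exact: l1|exact: l2].
by apply: filterI; [exact: r1|exact: r2].
Qed.

Lemma roelcke_uniformity : uniformity roelcke_entourage.
Proof.
split.
- split.
  + have FL := left_entourage_filter; have FR := right_entourage_filter.
    exists [set setT]; split => //; last first.
      by split=> _ ->; exact: filterT.
    split.
    * split=> // [_ _ -> ->|P Q + PT]; first by rewrite /= setTI.
      by rewrite PT subTset.
    * by move=> _ ->.
    * by move=> _ ->.
    * by move=> _ ->; exists setT.
  + move=> A B [E [uE bE EA]] [D [uD bD DB]].
    exists [set A | exists B1 B2, [/\ E B1, D B2 & B1 `&` B2 `<=` A]].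
    split; [exact: uniformity_join|exact: below_left_right_join|].
    by exists A, B; split => //; exact: subset_refl.
  + move=> A B AB [E [uE bE EA]]; exists E; split => //.
    by case: uE => FE _ _ _; exact: filterS EA.
- by move=> A [E [[_ dE _ _] _ EA]]; exact: dE.
- by move=> A [E [[FE dE iE sE] bE EA]]; exists E; split => //; exact: iE.
- move=> A [E [[FE dE iE sE] bE EA]]; have [B EB BA] := sE _ EA.
  by exists B => //; exists E.
Qed.

(* The group G equipped with its Roelcke uniformity. *)
Definition roelcke : Type := G.

HB.instance Definition _ := Choice.on roelcke.

Let roelcke_filter : Filter (roelcke_entourage : set_system (roelcke * roelcke)).
Proof. by case: roelcke_uniformity. Qed.

Let roelcke_diagonal (A : set (roelcke * roelcke)) :
  roelcke_entourage A -> (diagonal `<=` A).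
Proof. by case: roelcke_uniformity => _ + _ _ => /[apply]. Qed.

Let roelcke_inv (A : set (roelcke * roelcke)) :
  roelcke_entourage A -> roelcke_entourage (A^-1)%relation.
Proof. by case: roelcke_uniformity => _ _ + _ => /[apply]. Qed.

Let roelcke_split (A : set (roelcke * roelcke)) : roelcke_entourage A ->
  exists2 B, roelcke_entourage B & (B \; B `<=` A)%relation.
Proof. by case: roelcke_uniformity => _ _ _ + => /[apply]. Qed.

HB.instance Definition _ := isUniform.Build roelcke
  roelcke_filter roelcke_diagonal roelcke_inv roelcke_split.

Lemma roelcke_translation_unif_continuous (g : G) :
  unif_continuous ((fun h => g * h)%g : roelcke -> roelcke).
Proof.
pose m (xy : G * G) := ((g * xy.1)%g, (g * xy.2)%g).
move=> A [E [[FE dE iE sE] [lE rE] EA]].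
exists (filter_from E (fun B => m @^-1` B)); split; last by exists A.
- split.
  + apply: filter_from_filter; first by exists setT; exact: filterT.
    by move=> B C EB EC; exists (B `&` C) => //; exact: filterI.
  + by move=> B [C EC CB] [x y] /diagonalP ->; apply: CB; exact: dE EC _ _.
  + move=> B [C EC CB]; exists (C^-1)%relation; first exact: iE.
    by move=> [x y] ?; apply: CB.
  + move=> B [C EC CB]; have [D ED DC] := sE _ EC.
    exists (m @^-1` D); first by exists D.
    by move=> [x y] [z xz zy]; apply/CB/DC; exists (g * z)%g.
- split=> B [C EC CB].
    have [U nU UC] := lE _ EC; exists U => // -[x y] /= Uxy; apply/CB/UC => /=.
    by rewrite invgM -mulgA mulKg.
  have [U nU UC] := rE _ EC; exists [set h | U (g * h * g^-1)%g].
    have cg : continuous (fun h : G => g * h * g^-1)%g.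
      move=> h; have cl := @mulg_continuous G (g, h).
      have cr := @mulg_continuous G ((g * h)%g, (g^-1)%g).
      apply: (cvg_comp (fun h : G => ((g * h)%g, (g^-1)%g)) _ _ cr).
      apply: cvg_pair; last exact: cvg_cst.
      apply: (cvg_comp (fun h : G => (g, h)) _ _ cl).
      by apply: cvg_pair; [exact: cvg_cst|exact: cvg_id].
    by apply: (cg 1%g); rewrite /= mulg1 mulgV.
  move=> [x y] /= Uxy; apply/CB/UC => /=.
  by rewrite invgM !mulgA in Uxy *.
Qed.

End Roelcke.

(* A (Hausdorff) completion of U: a complete Hausdorff space together with a
   map of dense range inducing the uniformity of U. It is unique up to a unique
   uniform isomorphism. *)
Definition is_completion (U : uniformType) (X : completeType) (i : U -> X) :
    Prop :=
  [/\ hausdorff_space X,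
      dense (range i) &
      @entourage U = filter_from (@entourage X)
        (fun V => [set xy | V (i xy.1, i xy.2)])].

Definition roelcke_precompact (G : topologicalGroupType) : Prop :=
  exists (X : completeType) (i : roelcke G -> X),
    is_completion i /\ compact [set: X].

(* The complex numbers, with the topology, the uniformity and the C-linear
   structure given by the modulus. *)
Notation Cplx R := (R[i]^o).

Section RoelckeAlgebra.
Local Open Scope ring_scope.
Context (R : realType) (G : topologicalGroupType).
Local Notation C := (Cplx R).
Implicit Types f g : roelcke G -> C.

(* roelcke G carries the Roelcke uniformity, so unif_continuous is uniform
   continuity for it. *)
Definition Ro_b : {pred (roelcke G -> C)} :=
  [pred f | `[< bounded_fun f /\ unif_continuous f >]].

Lemma Ro_bP f : f \in Ro_b <->
  (exists2 M : C, 0 < M & forall x, `|f x| <= M) /\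
  (forall e : C, 0 < e -> exists2 E, entourage E &
     forall x y, E (x, y) -> `|f x - f y| < e).
Proof.
split=> [/asboolP[[M [Mr fM]] ucf]|[[M M0 fM] ucf]].
  split.
    have M1 : M < `|M| + 1 by rewrite (le_lt_trans (real_ler_norm Mr))// ltrDl.
    by exists (`|M| + 1) => [|x]; [rewrite ltr_wpDl|exact: fM].
  move=> e e0.
  have /ucf fe : entourage [set xy : C * C | ball xy.1 e xy.2].
    by rewrite -entourage_ballE; exists e.
  by exists (fun xy => `|f xy.1 - f xy.2| < e).
apply/asboolP; split.
  exists M; split; first exact: gtr0_real.
  by move=> N MN x _; apply: le_trans (fM x) _; exact: ltW.
move=> A; rewrite /= -entourage_ballE => -[e /= e0 eA].
have [E entE Ef] := ucf _ e0; apply: filterS entE => -[x y] /Ef xye.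
by apply: eA.
Qed.

Lemma Ro_b_cst (c : C) : cst c \in Ro_b.
Proof.
apply/Ro_bP; split.
  by exists (`|c| + 1) => [|x]; rewrite ?ltr_wpDl// lerDl.
move=> e e0; exists setT; first exact: entourageT.
by move=> x y _; rewrite subrr normr0.
Qed.

Lemma Ro_bD f g : f \in Ro_b -> g \in Ro_b -> f + g \in Ro_b.
Proof.
move=> /Ro_bP[[M M0 fM] fu] /Ro_bP[[N N0 gN] gu]; apply/Ro_bP; split.
  exists (M + N) => [|x]; first exact: addr_gt0.
  by rewrite (le_trans (ler_normD _ _))// lerD.
move=> e e0; have e2 : 0 < e / 2 by rewrite divr_gt0.
have [E1 h1 k1] := fu _ e2; have [E2 h2 k2] := gu _ e2.
exists (E1 `&` E2); first exact: filterI.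
move=> x y [xy1 xy2]; rewrite /= opprD addrACA (le_lt_trans (ler_normD _ _))//.
by rewrite [e]splitr ltrD ?k1 ?k2.
Qed.

Lemma Ro_bM f g : f \in Ro_b -> g \in Ro_b -> f * g \in Ro_b.
Proof.
move=> /Ro_bP[[M M0 fM] fu] /Ro_bP[[N N0 gN] gu]; apply/Ro_bP; split.
  exists (M * N) => [|x]; first exact: mulr_gt0.
  by rewrite normrM ler_pM.
move=> e e0.
have eN : 0 < e / 2 / N by rewrite !divr_gt0.
have eM : 0 < e / 2 / M by rewrite !divr_gt0.
have [E1 h1 k1] := fu _ eN; have [E2 h2 k2] := gu _ eM.
exists (E1 `&` E2); first exact: filterI.
move=> x y [/k1 xy1 /k2 xy2] /=.
have -> : f x * g x - f y * g y = (f x - f y) * g x + f y * (g x - g y).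
  by rewrite mulrBl mulrBr addrA subrK.
rewrite (le_lt_trans (ler_normD _ _))// [e]splitr ltrD// normrM.
  rewrite (@le_lt_trans _ _ (`|f x - f y| * N))//; first by rewrite ler_wpM2l.
  by rewrite -ltr_pdivlMr.
rewrite (@le_lt_trans _ _ (M * `|g x - g y|))//; first by rewrite ler_wpM2r.
by rewrite mulrC -ltr_pdivlMr.
Qed.

Lemma Ro_bZ (c : C) f : f \in Ro_b -> c *: f \in Ro_b.
Proof. by move=> fR; exact: Ro_bM (Ro_b_cst c) fR. Qed.

Lemma Ro_b_subring : subring_closed Ro_b.
Proof.
split=> [|f g fR gR|f g]; [exact: Ro_b_cst| |exact: Ro_bM].
by rewrite -[X in _ - X]scale1r -scaleNr; apply: Ro_bD => //; exact: Ro_bZ.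
Qed.

Lemma Ro_b_submod : subsemimod_closed Ro_b.
Proof.
by split=> [|c f]; [split; [exact: Ro_b_cst|exact: Ro_bD]|exact: Ro_bZ].
Qed.

Lemma Ro_b_conj f : f \in Ro_b -> (fun x => conjc (f x)) \in Ro_b.
Proof.
move=> /Ro_bP[[M M0 fM] fu]; apply/Ro_bP; split.
  by exists M => // x; rewrite normcJ.
move=> e /fu[E hE k]; exists E => // x y /k.
by rewrite -rmorphB normcJ.
Qed.

Lemma Ro_b_translate (g : G) f :
  f \in Ro_b -> (fun h : roelcke G => f (g^-1 * h)%g) \in Ro_b.
Proof.
move=> /Ro_bP[[M M0 fM] fu]; apply/Ro_bP; split; first by exists M.
move=> e /fu[E /(roelcke_translation_unif_continuous g^-1%g) hE k].
by exists (fun xy => E ((g^-1 * xy.1)%g, (g^-1 * xy.2)%g)) => // x y /k.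
Qed.

Record RoB := MkRoB {
  RoB_val :> roelcke G -> C;
  RoB_valP : RoB_val \in Ro_b
}.

HB.instance Definition _ := [isSub for RoB_val].
HB.instance Definition _ := [Choice of RoB by <:].
HB.instance Definition _ := GRing.SubChoice_isSubComPzRing.Build _ Ro_b RoB
  Ro_b_subring.
HB.instance Definition _ := GRing.SubZmodule_isSubLmodule.Build R[i] _ Ro_b RoB
  Ro_b_submod.

Definition RoB_star (f : RoB) : RoB := MkRoB (Ro_b_conj (RoB_valP f)).

Definition RoB_translate (g : G) (f : RoB) : RoB :=
  MkRoB (Ro_b_translate g (RoB_valP f)).

(* The topology of pointwise convergence on RoB -> C induces the weak-*
   topology; a unital *-homomorphism of C*-algebras is automatically bounded. *)
Definition characters : set {ptws RoB -> C} :=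
  [set phi : RoB -> C | [/\ linear phi, monoid_morphism phi &
     forall f : RoB, phi (RoB_star f) = conjc (phi f)]].

Definition gelfand : Type := set_type characters.

HB.instance Definition _ := Topological.on gelfand.

Lemma gelfand_act_subproof (g : G) (phi : gelfand) :
  characters (fun f : RoB => val phi (RoB_translate g^-1%g f)).
Proof.
have [lphi mphi sphi] := set_mem (valP phi).
split.
- move=> a u v; rewrite -lphi; congr (val phi _).
  by apply: val_inj.
- split; last first.
    by move=> u v; rewrite -mphi.2; congr (val phi _); apply: val_inj.
  by rewrite -[RHS]mphi.1; congr (val phi _); apply: val_inj.
- by move=> f; rewrite -sphi; congr (val phi _); apply: val_inj.
Qed.

Definition gelfand_act (g : G) (phi : gelfand) : gelfand :=
  SigSub (mem_set (gelfand_act_subproof g phi)).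

End RoelckeAlgebra.

Section Flows.
Context (G : Type) (X : topologicalType) (act : G -> X -> X).

Definition subflow (Y : set X) : Prop :=
  [/\ Y !=set0, closed Y & forall g, act g @` Y `<=` Y].

Definition minimal_subflow (Y : set X) : Prop :=
  subflow Y /\ forall Z, subflow Z -> Z `<=` Y -> Z = Y.

End Flows.

(* Main.v *)
Require Import Defs.
From HB Require Import structures.
From mathcomp Require Import all_boot all_order all_algebra.
From mathcomp Require Import complex.
From mathcomp Require Import all_classical all_reals topology normedtype.

Set Implicit Arguments.
Unset Strict Implicit.
Unset Printing Implicit Defensive.

Import Order.TTheory GRing.Theory Num.Theory.
Import numFieldTopology.Exports numFieldNormedType.Exports.

Local Open Scope classical_set_scope.

(** Both conditions say the same thing about the group G = Aut(F): for every
entourage E of the Roelcke uniformity and every finite D in G there is a finite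
K in G such that every h in G has some k in K for which the points g k h, g in
D, are pairwise E-close. This is [synchronizing] below. It is a fixed point
property made finite: the evaluation at k h is almost invariant under D, and
only finitely many candidates k have to be tried, whatever h is.

Dynamical side. Evaluations are dense in the Gelfand space
([evaluation_dense]), so a synchronizing statement about all h passes to all
characters: a translate by one of finitely many k makes any point of a subflow
almost invariant under finitely many elements, on finitely many functions. By
compactness every subflow contains a fixed point, hence minimal subflows are
singletons ([synchronizing_trivial_minimal]). Conversely, suppose that E is an
equivalence relation with finitely many classes, which Roelcke-precompactness
provides, and that it fails to synchronize D. The characters that vanish on
every translate of the products, over g in D, of the indicators of g^-1 c, for
each class c, form a subflow, non-empty by compactness. It would contain a
fixed point; on a fixed point the product is a power of the value at the
indicator of c, so all the indicators vanish there, although they cover G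
([trivial_minimal_synchronizing]).

Combinatorial side. Basic Roelcke entourages of Aut(F) are the partitions into
double cosets of the stabilizer of a finite set S
([entourage_double_coset]). By ultrahomogeneity a joint embedding of two finite
structures is a pair of partial automorphisms, and its pattern is a double
coset. A colouring a |-> [c a, z] is thus h |-> the double coset of g k h, where
h extends z, k carries the chosen copy of B back to B, and g carries a(A) back
to A. The finitely many copies of B in C are the finite set K of the
synchronizing property, and the finitely many copies of A in B are the set D
([definable_ramsey_synchronizing], [synchronizing_definable_ramsey]). *)

(** * Compact flows *)

(** The finite intersection property in terms of finite lists of conditions; the
empty list says that [K] is non-empty. *)
Lemma compact_fip (T : topologicalType) (K : set T) (I : eqType)
    (C : I -> set T) :
  compact K -> (forall i, closed (C i)) ->
  (forall s : seq I, exists2 x, K x & forall i, i \in s -> C i x) ->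
  exists2 x, K x & forall i, C i x.
Proof.
move=> cK cC fip.
pose F := filter_from [set: seq I]
  (fun s => K `&` [set x | forall i, i \in s -> C i x]).
have FF : ProperFilter F.
  apply: filter_from_proper; last first.
    by move=> s _; have [x Kx Cx] := fip s; exists x.
  apply: filter_from_filter; first by exists nil.
  move=> s t _ _; exists (s ++ t) => // x [Kx Cx].
  by split; split=> // i ?; apply: Cx; rewrite mem_cat; apply/orP; [left|right].
have [x [Kx clx]] : K `&` cluster F !=set0.
  by apply: cK; exists nil => // x [].
exists x => // i; apply: cC => B Bx; apply: clx => //.
by exists [:: i] => // y [_]; apply; rewrite mem_head.
Qed.

Section Flows.
Context (G : Type) (X : topologicalType) (act : G -> X -> X).

(** Zorn's lemma is applied to the complements in [Y]: a chain of complements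
has its union for upper bound, since the intersection of a chain of subflows of
a compact space is non-empty. *)
Lemma subflow_contains_minimal (Y : set X) : compact [set: X] ->
  subflow act Y -> exists2 Z, minimal_subflow act Z & Z `<=` Y.
Proof.
move=> cX sY; have [Y0 cY iY] := sY.
have [F FP tF|A [[A0 cA iA] mA]] :=
    @Zorn_bigcup X (fun A => subflow act (Y `\` A)); last first.
  exists (Y `\` A); last by move=> x [].
  split=> // Z sZ ZA.
  have AZ : A `<=` ~` Z by move=> x Ax /ZA[_].
  have YZ : Y `\` ~` Z = Z by rewrite setDE setCK setIidr// => x /ZA[].
  have [ZcA|nZA] := pselect (~` Z `<=` A); last first.
    by case: (mA (~` Z)); rewrite ?YZ.
  by rewrite -[LHS]YZ; congr (_ `\` _); apply/seteqP.
have sF (A : set_type F) : subflow act (Y `\` val A).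
  by apply: FP; apply: set_mem; exact: valP.
split.
- have [A|s|x Yx Fx] := @compact_fip X Y (set_type F) (fun A => Y `\` val A)
    (subclosed_compact cY cX (@subsetT _ _)).
  + by have [] := sF A.
  + case: s => [|A s]; first by have [x Yx] := Y0; exists x.
    (* In a chain, a finite subfamily has a largest complement. *)
    have [B sB] : exists B : set_type F,
        forall D, D \in A :: s -> val D `<=` val B.
      elim: s => [|D s [B sB]].
        by exists A => D; rewrite inE => /eqP ->; exact: subset_refl.
      have [BD|DB] := tF _ _ (set_mem (valP B)) (set_mem (valP D)).
        exists D => E; rewrite !inE => /or3P[EA|/eqP ->|Es] //.
          by apply: subset_trans BD; apply: sB; rewrite inE EA.
        by apply: subset_trans BD; apply: sB; rewrite inE Es orbT.
      exists B => E; rewrite !inE => /or3P[EA|/eqP ->//|Es].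
        by apply: sB; rewrite inE EA.
      by apply: sB; rewrite inE Es orbT.
    have [[x [Yx Bx]] _ _] := sF B.
    by exists x => // D Ds; split=> // Dx; apply: Bx; exact: sB Dx.
  + by exists x; split=> // -[A FA Ax]; have [] := Fx (SigSub (mem_set FA)).
- have -> : Y `\` \bigcup_(A in F) A = Y `&` \bigcap_(A in F) (Y `\` A).
    apply/seteqP; split=> x [Yx nF]; split=> //.
      by move=> A FA; split=> // Ax; apply: nF; exists A.
    by move=> [A FA Ax]; have [] := nF A FA.
  by apply: closedI => //; apply: closed_bigI => A /FP[].
- move=> g _ [x [Yx nF] <-]; split; first by apply: (iY g); exists x.
  move=> [A FA Agx]; have [_ _ iA] := FP _ FA.
  have [|//] := iA g (act g x); exists x => //; split=> // Ax.
  by apply: nF; exists A.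
Qed.
End Flows.

(** * Characters of the algebra of Roelcke uniformly continuous functions *)

Section Gelfand.
Local Open Scope ring_scope.
Context (R : realType) (G : topologicalGroupType).
Local Notation C := (Cplx R).
Local Notation X := (gelfand R G).
Local Notation A := (RoB R G).
Implicit Types (phi : X) (f : A) (g h : G).

(** Naming the underlying function lets linearity and multiplicativity be
inferred. *)
Definition character phi : A -> C := val phi.

Lemma character_linear phi : linear (character phi).
Proof. by have [] := set_mem (valP phi). Qed.

Lemma character_monoid phi : monoid_morphism (character phi).
Proof. by have [] := set_mem (valP phi). Qed.

Lemma character_star phi f :
  character phi (RoB_star f) = conjc (character phi f).
Proof. by have [] := set_mem (valP phi). Qed.

HB.instance Definition _ phi :=
  GRing.isLinear.Build _ _ _ _ (character phi) (character_linear phi).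
HB.instance Definition _ phi :=
  GRing.isMonoidMorphism.Build _ _ (character phi) (character_monoid phi).

Lemma gelfand_ext phi psi : character phi =1 character psi -> phi = psi.
Proof. by move=> e; apply/val_inj/funext. Qed.

Lemma character_act g phi f :
  character (gelfand_act g phi) f = character phi (RoB_translate g^-1%g f).
Proof. by []. Qed.

Lemma evaluation_subproof h : characters (fun f : A => f h).
Proof. by split. Qed.

Definition evaluation h : X := SigSub (mem_set (evaluation_subproof h)).

Lemma character_evaluation h f : character (evaluation h) f = f h.
Proof. by []. Qed.

Definition RoB_cst (c : R[i]) : A := MkRoB (Ro_b_cst G (c : C)).

Lemma RoB_cstE (c : R[i]) : RoB_cst c = c *: (1 : A).
Proof. by apply/val_inj/funext => h; exact/esym/mulr1. Qed.

Lemma character_cst phi (c : R[i]) : character phi (RoB_cst c) = c.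
Proof. by rewrite RoB_cstE linearZ/= rmorph1; exact: mulr1. Qed.

(** A function bounded away from zero has a uniformly continuous inverse:
1/f(x) - 1/f(y) = (f(y) - f(x)) / (f(x) f(y)), and the denominator is at least
[d ^+ 2]. *)
Lemma RoB_invertible f (d : C) : 0 < d -> (forall h, d <= `|f h|) ->
  exists f', f * f' = 1.
Proof.
move=> d0 fd.
have fN0 h : f h != 0 by rewrite -normr_gt0; apply: lt_le_trans (fd h).
have fV : (fun h => (f h)^-1) \in @Ro_b R G.
  have /Ro_bP[_ fu] := RoB_valP f.
  apply/Ro_bP; split.
    exists d^-1; rewrite ?invr_gt0// => h.
    by rewrite normfV lef_pV2 ?posrE ?normr_gt0.
  move=> e e0; have [E hE k] := fu _ (mulr_gt0 e0 (mulr_gt0 d0 d0)).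
  exists E => // x y /k xy.
  have -> : (f x)^-1 - (f y)^-1 = (f y - f x) / (f x * f y).
    by rewrite mulrBl invfM mulrCA mulfV// mulr1 mulVKf.
  rewrite normrM distrC normfV ltr_pdivrMr; last by rewrite normr_gt0 mulf_neq0.
  apply: lt_le_trans xy _; rewrite ler_pM2l// normrM ler_pM// ltW//.
exists (MkRoB fV); apply: val_inj; apply/funext => h.
exact: mulfV (fN0 h).
Qed.

(** Otherwise the sum of the |f - phi(f)|^2, f in [s], is bounded below, hence
invertible, whereas [phi] kills it. This is the only source of information on
arbitrary characters: it yields the bound |phi(f)| <= sup |f| and transfers
pointwise statements on G to the whole Gelfand space. *)
Lemma evaluation_dense phi (s : seq A) (d : C) : 0 < d ->
  exists h, forall f, f \in s -> `|f h - character phi f| < d.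
Proof.
move=> d0; apply: contrapT => nh.
pose sq f := f * RoB_star f.
pose P := \sum_(f <- s) sq (f - RoB_cst (character phi f)).
have PE h : P h = \sum_(f <- s) `|f h - character phi f| ^+ 2.
  rewrite -character_evaluation linear_sum; apply: eq_bigr => f _ /=.
  by rewrite rmorphM/= character_star linearB/= character_cst normCK.
have [|h|Q PQ] := @RoB_invertible P (d ^+ 2); first exact: exprn_gt0.
  rewrite PE ger0_norm; last by apply: sumr_ge0 => f _; exact: exprn_ge0.
  have [f [fs fh]] : exists f, f \in s /\ ~~ (`|f h - character phi f| < d).
    apply: contrapT => nf; apply: nh; exists h => f fs.
    apply: contrapT => /negP fh.
    by apply: nf; exists f.
  rewrite (big_rem f)//= ler_wpDr//.
    by apply: sumr_ge0 => ? _; exact: exprn_ge0.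
  rewrite lerXn2r ?nnegrE ?normr_ge0 ?(ltW d0)//.
  by rewrite real_leNgt ?normr_real ?(gtr0_real d0).
have : character phi (P * Q) = 1 by rewrite PQ rmorph1.
rewrite rmorphM/= linear_sum big1 => [|f _].
  by rewrite mul0r => /esym/eqP; rewrite oner_eq0.
by rewrite /= rmorphM/= linearB/= character_cst subrr mul0r.
Qed.
End Gelfand.

Section Compactness.
Local Open Scope ring_scope.
Context (R : realType) (G : topologicalGroupType).
Local Notation C := (Cplx R).
Local Notation X := (gelfand R G).
Local Notation A := (RoB R G).

Lemma character_continuous (f : A) :
  continuous (fun phi : X => character phi f).
Proof.
move=> phi; apply: (@continuous_comp X {ptws A -> C} C set_val (@^~ f)).
  exact: initial_continuous.
exact: (@proj_continuous A (fun=> C) f).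
Qed.

(** Converse of the continuity of evaluations: the topology is the coarsest one
that makes them continuous. *)
Lemma gelfand_cvg (F : set_system X) (phi : X) : Filter F ->
  (forall f, (fun psi : X => character psi f) @ F --> character phi f) ->
  F --> phi.
Proof.
move=> FF cF.
have cF' : {ptws, (fun psi : X => character psi) @ F --> character phi}.
  apply/cvg_sup => f; apply/cvg_image.
    by apply/seteqP; split=> // z _; exists (cst z).
  move=> B /cF FB; exists ((fun psi : A -> C => psi f) @^-1` B) => //.
  by apply/seteqP; split=> [_ [psi ? <-]//|z Bz]; exists (cst z).
move=> B [_ [[W oW <-] Wphi WB]].
suff : F (@set_val _ _ @^-1` W) by apply: filterS.
by apply: cF'; apply: open_nbhs_nbhs.
Qed.

Lemma real_complex_continuous : continuous (fun x : R => x%:C%C : C).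
Proof.
move=> x; apply/cvgrPdist_lt => e e0.
have eE : e = (complex.Re e)%:C%C by rewrite RRe_real// gtr0_real.
have e0' : 0 < complex.Re e by rewrite -ltcR -eE.
near=> y; rewrite -rmorphB normc_def/= expr0n addr0 sqrtr_sqr eE ltcR.
by near: y; apply: cvgr_dist_lt.
Unshelve. all: by end_near. Qed.

(** Discs lie in squares, which are images of compact subsets of the real
plane. *)
Lemma bounded_in_compact (M : C) : exists2 K : set C, compact K &
  forall z, `|z| <= M -> K z.
Proof.
pose r := complex.Re M.
pose sq := `[- r, r]%classic `*` `[- r, r]%classic.
pose j (xy : R * R) : C := xy.1%:C%C + 'i%C * xy.2%:C%C.
exists (j @` sq).
  apply: continuous_compact.
    apply: continuous_subspaceT => xy; apply: cvgD.
      apply: (@continuous_comp _ _ _ fst); first exact: cvg_fst.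
      exact: real_complex_continuous.
    apply: cvgM; first exact: cvg_cst.
    apply: (@continuous_comp _ _ _ snd); first exact: cvg_snd.
    exact: real_complex_continuous.
  by apply: compact_setX; exact: segment_compact.
move=> z zM; exists (complex.Re z, complex.Im z); last first.
  by rewrite /j /= -complexE.
have : (Num.sqrt (complex.Re z ^+ 2 + complex.Im z ^+ 2)) <= r.
  by rewrite -lecR -normc_def RRe_real// ger0_real// (le_trans _ zM).
move=> zr; rewrite /sq /= !in_itv/= -!ler_norml.
by split; apply: le_trans zr;
  rewrite -sqrtr_sqr ler_wsqrtr// ?lerDl ?lerDr sqr_ge0.
Qed.

(** Along an ultrafilter all the values phi(f) converge, because they stay in a
compact set that depends on f only. The limit is again a character, as the
algebraic identities pass to the limit. *)
Lemma gelfand_compact : compact [set: X].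
Proof.
rewrite compact_ultra => F UF _.
have FF : ProperFilter F by exact: ultra_proper.
have cF (f : A) : exists z : C, (fun phi : X => character phi f) @ F --> z.
  have /Ro_bP[[M M0 fM] _] := RoB_valP f.
  have [K cK KM] := bounded_in_compact (M + 1).
  have FK : F ((fun phi : X => character phi f) @^-1` K).
    apply: filterE => phi; apply: KM.
    have [h /(_ f (mem_head _ _)) fh] := evaluation_dense phi [:: f] ltr01.
    rewrite -[character phi f](subrK (f h)) addrC.
    apply: le_trans (ler_normD _ _) _; apply: lerD; first exact: fM.
    by rewrite distrC ltW.
  have [z [_ clz]] := cK ((fun phi : X => character phi f) @ F) _ FK.
  exists z => B Bz.
  have [//|nB] :=
    in_ultra_setVsetC ((fun phi : X => character phi f) @^-1` B) UF.
  by have [y []] := clz (~` B) B nB Bz.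
have {cF}[lim limP] := choice cF.
have CH : hausdorff_space C by exact: norm_hausdorff.
have uniq f (z : C) : (fun phi : X => character phi f) @ F --> z -> lim f = z.
  by move=> cz; apply: (cvg_unique CH) cz; exact: limP.
have clim : characters (lim : RoB R G -> C).
  split.
  - move=> a u v; apply: uniq.
    under eq_fun do rewrite linearP.
    apply: cvgD; last exact: limP.
    by apply: cvgM; [exact: cvg_cst|exact: limP].
  - split.
      apply: uniq; under eq_fun do rewrite rmorph1; exact: cvg_cst.
    move=> u v; apply: uniq; under eq_fun do rewrite rmorphM.
    by apply: cvgM; exact: limP.
  - move=> f; apply: uniq; under eq_fun do rewrite character_star.
    apply/cvgrPdist_lt => e e0.
    have /cvgrPdist_lt/(_ e e0) := limP f; apply: filterS => phi.
    by rewrite -rmorphB normcJ.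
exists (SigSub (mem_set clim)); split => //.
by apply: gelfand_cvg => f; exact: limP.
Qed.

End Compactness.

(** * Trivial minimal subflows and synchronization *)

Section Dynamics.
Local Open Scope ring_scope.
Context (R : realType) (G : topologicalGroupType).
Local Notation C := (Cplx R).
Local Notation X := (gelfand R G).
Local Notation A := (RoB R G).
Local Notation act := (@gelfand_act R G).
Implicit Types (phi psi : X) (f : A) (g h k : G).

Lemma continuous_sub (T : topologicalType) (F F' : T -> C) :
  continuous F -> continuous F' -> continuous (fun x => F x - F' x).
Proof. by move=> cF cF' x; apply: cvgB; [exact: cF|exact: cF']. Qed.

Lemma closed_norm_le (T : topologicalType) (F : T -> C) (e : C) :
  e \is Num.real -> continuous F -> closed [set x | `|F x| <= e].
Proof.
move=> er cF x clx; rewrite /= real_leNgt// ?normr_real//; apply/negP => ex.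
have /cvgrPdist_lt/(_ (`|F x| - e))/(_ _)/clx[|y [/= ye xy]] := cF x.
  by rewrite subr_gt0.
have := le_lt_trans (ler_normD (F y) (F x - F y)) (ler_ltD ye xy).
by rewrite [in ltLHS]addrC subrK [ltRHS]addrC subrK ltxx.
Qed.

(** The order on the complex numbers is partial, so the minimum is replaced by
d d' / (d + d'). *)
Lemma pos_lower_bound (d d' : C) : 0 < d -> 0 < d' ->
  exists e : C, [/\ 0 < e, e < d & e < d'].
Proof.
move=> d0 d'0; have dd' : 0 < d + d' := addr_gt0 d0 d'0.
exists (d * d' / (d + d')); split; first exact: divr_gt0 (mulr_gt0 d0 d'0) dd'.
  by rewrite ltr_pdivrMr// ltr_pM2l// ltrDr.
by rewrite ltr_pdivrMr// mulrC ltr_pM2l// ltrDl.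
Qed.

(** The slack [d] is left for the approximation of a character by an
evaluation. *)
Lemma uniform_moduli (s : seq (A * C)) : (forall fe, fe \in s -> 0 < fe.2) ->
  exists E, exists d : C, [/\ roelcke_entourage E, 0 < d &
    forall fe, fe \in s ->
      forall x y, E (x, y) -> `|fe.1 x - fe.1 y| + d < fe.2].
Proof.
have [[entT entI _] _ _ _] := @roelcke_uniformity G.
elim: s => [|[f e] s IHs] s0; first by exists setT, 1; split=> //; exact: ltr01.
have [fe fes|E [d [entE d0 Ed]]] := IHs.
  by apply: s0; rewrite inE fes orbT.
have e0 : 0 < e by have := s0 (f, e) (mem_head _ _).
have e20 : 0 < e / 2 by rewrite divr_gt0.
have /Ro_bP[_ /(_ _ e20)[E' entE' E'f]] := RoB_valP f.
have [d' [d'0 d'd d'e]] := pos_lower_bound d0 e20.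
exists (E `&` E'), d'; split=> //; first exact: entI.
move=> fe; rewrite inE => /predU1P[->|fes] x y [Exy E'xy].
  by rewrite /= [ltRHS]splitr; apply: ltrD => //; exact: E'f.
by apply: le_lt_trans (Ed fe fes x y Exy); rewrite lerD2l ltW.
Qed.

Lemma RoB_translateB g f f' :
  RoB_translate g (f - f') = RoB_translate g f - RoB_translate g f'.
Proof. exact/val_inj. Qed.

Lemma gelfand_actM g h phi : act g (act h phi) = act (g * h)%g phi.
Proof.
apply: gelfand_ext => f; rewrite !character_act; congr (character phi _).
by apply/val_inj/funext => x /=; rewrite !invgK mulgA.
Qed.

Lemma gelfand_act_continuous g f :
  continuous (fun phi => character (act g phi) f).
Proof. exact: character_continuous. Qed.

(** The quantifiers over [K] and [h] come in this order: the finite set [K]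
serves all [h] at once, which is what survives in the limit. *)
Definition synchronizing (E : set (G * G)) := forall D : seq G,
  exists K : seq G, forall h, exists2 k, k \in K &
    forall g g', g \in D -> g' \in D -> E (g * k * h, g' * k * h)%g.

(** In a minimal subflow Y, the points almost fixed by one g, as seen by one
function f with error e, form a closed set. Synchronization, with 1 added to
the set of all g under consideration, makes these sets have the finite
intersection property, so Y contains a fixed point. *)
Lemma synchronizing_trivial_minimal :
  (forall E, roelcke_entourage E -> synchronizing E) ->
  forall Y : set X, minimal_subflow act Y -> exists phi, Y = [set phi].
Proof.
move=> sync Y [[[psi Ypsi] cY iY] mY].
pose defect (i : A * G * C) psi :=
  character (act i.1.2 psi) i.1.1 - character psi i.1.1.
have cdefect i : continuous (defect i).
  apply: continuous_sub; last exact: character_continuous.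
  exact: gelfand_act_continuous.
pose B (i : A * G * C) := [set psi | 0 < i.2 -> `|defect i psi| <= i.2].
have cB i : closed (B i).
  rewrite /B; have [i0|ni0] := boolP (0 < i.2).
    rewrite (_ : [set _ | _] = [set psi | `|defect i psi| <= i.2]).
      by apply: closed_norm_le => //; exact: gtr0_real.
    by apply/seteqP; split=> [phi /(_ isT)|phi + _].
  by rewrite (_ : [set _ | _] = setT) ?closedT//; apply/seteqP; split.
have cptY : compact Y.
  by apply: subclosed_compact cY (@gelfand_compact R G) _.
have [s|phi Yphi Bphi] := compact_fip cptY cB.
  have [|E [d [entE d0 Ed]]] :=
    @uniform_moduli [seq (i.1.1, i.2) | i <- s & 0 < i.2].
    by move=> _ /mapP[i + ->]; rewrite mem_filter => /andP[].
  have [K Kh] := sync E entE (1%g :: [seq i.1.2 | i <- s]).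
  pose D (ki : G * (A * G * C)) := RoB_translate ki.1^-1%g
    (RoB_translate ki.2.1.2^-1%g ki.2.1.1 - ki.2.1.1).
  (* [D (k, i)] measures how far the translate of [psi] by [k] is from
     satisfying condition [i]. All [k] in [K] are treated together because the
     good one is known only after [h]. *)
  have [h hD] := evaluation_dense psi
    [seq D (k, i) | k <- K, i <- s] d0.
  have [k kK kE] := Kh h.
  exists (act k psi); first by apply: (iY k); exists psi.
  move=> i si i0.
  have -> : defect i (act k psi) = character psi (D (k, i)).
    by rewrite /defect /D RoB_translateB linearB.
  apply/ltW.
  have -> : character psi (D (k, i)) =
    D (k, i) h - (D (k, i) h - character psi (D (k, i))) by rewrite subKr.
  apply: le_lt_trans (ler_normB _ _) _.
  have /hD hd : D (k, i) \in [seq D (k, i) | k <- K, i <- s].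
    by apply/allpairsP; exists (k, i).
  have Eh : E (i.1.2 * k * h, k * h)%g.
    have := kE i.1.2 1%g; rewrite mul1g; apply; last exact: mem_head.
    by rewrite inE; apply/orP; right; apply/mapP; exists i.
  have si' : (i.1.1, i.2) \in [seq (i.1.1, i.2) | i <- s & 0 < i.2].
    by apply/mapP; exists i => //; rewrite mem_filter i0.
  apply: lt_trans (Ed _ si' _ _ Eh).
  apply: ler_ltD hd.
  have -> : D (k, i) h = i.1.1 (i.1.2 * k * h)%g - i.1.1 (k * h)%g.
    rewrite /D /= !invgK -mulgA; reflexivity.
  exact: lexx.
have fixphi g : act g phi = phi.
  apply: gelfand_ext => f; apply/eqP; rewrite -subr_eq0 -normr_le0.
  rewrite real_leNgt ?real0 ?normr_real//; apply/negP => n0.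
  have := Bphi (f, g, `|defect (f, g, 0) phi| / 2); rewrite /B /=.
  move=> /(_ (divr_gt0 n0 (ltr0Sn _ 1))).
  rewrite real_leNgt ?gtr0_real ?divr_gt0// => /negP; apply.
  by rewrite ltr_pdivrMr// ltr_pMr// ltr1n.
exists phi; apply/esym/mY; last by move=> _ ->.
split; first by exists phi.
  rewrite (_ : [set phi] =
    \bigcap_f [set psi | `|character psi f - character phi f| <= 0]).
    apply: closed_bigI => f _; apply: closed_norm_le; first exact: real0.
    apply: continuous_sub; last exact: cst_continuous.
    exact: character_continuous.
  apply/seteqP; split=> [_ -> f _|psi' psiE]; first by rewrite /= subrr normr0.
  apply: gelfand_ext => f; apply/eqP; rewrite -subr_eq0 -normr_le0; exact: psiE.
by move=> g _ [_ -> <-]; exact: fixphi.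
Qed.

Lemma indicator_Ro_b (E : set (G * G)) (x : G) : roelcke_entourage E ->
  (forall g h, E (g, h) -> E (x, g) <-> E (x, h)) ->
  (fun h => (`[< E (x, h) >])%:R : C) \in @Ro_b R G.
Proof.
move=> entE eqE; apply/Ro_bP; split.
  by exists 1 => [|h]; [exact: ltr01|case: asbool; rewrite /= ?normr1 ?normr0].
move=> e e0; exists E => // g h /eqE gh.
by rewrite (asbool_equiv_eq gh) subrr normr0.
Qed.

(** Suppose that [D] cannot be synchronized. The function [P x] is the indicator
of the set of those h that are E-synchronized by [D] into the class of [x]; that
no finite set K serves all h implies that the conditions (k phi)(P x) = 0
have the finite intersection property, already among evaluations. A fixed point
[phi] satisfying them kills [P x], a product of factors on which [phi] takes
the same value, hence kills the indicator of each class; but finitely many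
classes cover G. *)
Lemma trivial_minimal_synchronizing (E : set (G * G)) (r : seq G) :
  (forall Y : set X, minimal_subflow act Y -> exists phi, Y = [set phi]) ->
  roelcke_entourage E ->
  (forall g h, E (g, h) -> E (h, g)) ->
  (forall g h k, E (g, h) -> E (h, k) -> E (g, k)) ->
  (forall h, exists2 x, x \in r & E (x, h)) ->
  synchronizing E.
Proof.
move=> trivial_minimal entE symE trE rE D; apply: contrapT => nK.
have eqE x g h : E (g, h) -> E (x, g) <-> E (x, h).
  by move=> gh; split=> /trE; apply; [|exact: symE].
pose ind x := MkRoB (indicator_Ro_b (x := x) entE (eqE x)).
pose P x := \prod_(g <- D) RoB_translate g^-1%g (ind x).
pose Z (kx : G * G) := [set phi | `|character (act kx.1 phi) (P kx.2)| <= 0].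
pose Y := \bigcap_kx Z kx.
have cZ kx : closed (Z kx).
  by apply: closed_norm_le; [exact: real0|exact: gelfand_act_continuous].
have sY : subflow act Y.
  split.
  - have [s|phi _ Zphi] := compact_fip (@gelfand_compact R G) cZ; last first.
      by exists phi => kx _; exact: Zphi.
    have [h hK] : exists h, forall k, k \in unzip1 s ->
        ~ forall g g', g \in D -> g' \in D -> E (g * k * h, g' * k * h)%g.
      apply: contrapT => nh; apply: nK; exists (unzip1 s) => h.
      apply: contrapT => nk; apply: nh; exists h => k ks Ek.
      by apply: nk; exists k.
    exists (evaluation R h) => // -[k x] kxs /=.
    rewrite /Z /= normr_le0 rmorph_prod /=; apply/negPn/negP => n0.
    apply: (hK k); first by apply/mapP; exists (k, x).
    suff xE g : g \in D -> E (x, g * k * h)%g.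
      by move=> g g' /xE/symE + /xE; exact: trE.
    move=> gD; apply: contrapT => /asboolPn nE; move/negP: n0; apply.
    rewrite prodf_seq_eq0; apply/hasP; exists g => //=.
    rewrite !character_act character_evaluation /= !invgK mulgA.
    by rewrite (negbTE nE).
  - by apply: closed_bigI => kx _; exact: cZ.
  - move=> g _ [phi Yphi <-] [k x] _; rewrite /Z /= gelfand_actM.
    exact: (Yphi (k * g, x)%g).
have [M mM MY] := subflow_contains_minimal (@gelfand_compact R G) sY.
have [phi Mphi] := trivial_minimal M mM.
have phiM : M phi by rewrite Mphi.
have fixphi g : act g phi = phi.
  have [[_ _ iM] _] := mM; have : M (act g phi) by apply: (iM g); exists phi.
  by rewrite Mphi.
have ind0 x : character phi (ind x) = 0.
  have := MY _ phiM (1%g, x) I; rewrite /Z /= fixphi normr_le0 rmorph_prod.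
  rewrite prodf_seq_eq0 => /hasP[g _ /eqP].
  by rewrite /= -character_act fixphi.
have [h hr] := evaluation_dense phi [seq ind x | x <- r] ltr01.
have [x xr xh] := rE h.
have /hr : ind x \in [seq ind x | x <- r] by exact: map_f.
by rewrite ind0 subr0 /= asboolT// normr1 ltxx.
Qed.

End Dynamics.

(** * The Roelcke uniformity of an automorphism group *)

Section DoubleCosets.
Context (L : language) (F : structure L).
Local Notation G := (Aut F).
Implicit Types (g h k u : G) (S T : set F).

Lemma AutVK g x : (g^-1)%g (g x) = x. Proof. exact: iso_funK. Qed.
Lemma AutKV g x : g ((g^-1)%g x) = x. Proof. exact: iso_invK. Qed.

(** The pairs (g, h) with h in V g V, where V is the pointwise stabilizer of S:
u is the left factor, and u g and h agree on S when u g is in h V. *)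
Definition double_coset S : set (G * G) :=
  [set gh : G * G | exists2 u, stabilizer S u &
    forall x, S x -> u (gh.1 x) = gh.2 x].

Lemma stabilizerV S u : stabilizer S u -> stabilizer S u^-1%g.
Proof. by move=> Su x Sx; have := AutVK u x; rewrite (Su x Sx). Qed.

Lemma double_coset_refl S g : double_coset S (g, g).
Proof. by exists 1%g. Qed.

Lemma double_coset_sym S g h : double_coset S (g, h) -> double_coset S (h, g).
Proof.
move=> [u Su /= gh]; exists u^-1%g; first exact: stabilizerV.
by move=> x Sx; have := AutVK u (g x); rewrite gh.
Qed.

Lemma double_coset_trans S g h k :
  double_coset S (g, h) -> double_coset S (h, k) -> double_coset S (g, k).
Proof.
move=> [u Su /= gh] [v Sv /= hk]; exists (v * u)%g => x Sx.
  by rewrite -[LHS]/(v (u x)) Su// Sv.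
by rewrite -[LHS]/(v (u (g x))) gh// hk.
Qed.

Lemma double_cosetS S T : S `<=` T -> double_coset T `<=` double_coset S.
Proof.
move=> ST [g h] [u Tu gh]; exists u => x /ST; [exact: Tu|exact: gh].
Qed.

(** The sets that contain the relation form a uniformity, as it is an
equivalence, and it lies below both one-sided uniformities because V g V
contains V g and g V. *)
Lemma double_coset_entourage S : finite_set S ->
  roelcke_entourage (double_coset S).
Proof.
move=> fS; exists [set A | double_coset S `<=` A]; split=> //; last first.
  have nS : nbhs (1%g : G) (stabilizer S).
    by apply/Aut_nbhsP; exists S => // h hS x Sx; rewrite hS.
  split=> A SA; exists (stabilizer S) => // -[g h] /= gh; apply: SA.
    by exists 1%g => // x Sx; apply/esym; move: x Sx; exact/Aut_stabE.
  exists (h * g^-1)%g => [|x Sx]; last by exact: congr1 (AutVK g x).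
  by have := stabilizerV gh; rewrite invgM invgK.
split.
- split=> //.
    by move=> A B SA SB x Sx; split; [exact: SA|exact: SB].
  by move=> A B AB SA; exact: subset_trans AB.
- by move=> A SA [g h] /diagonalP ->; apply: SA; exact: double_coset_refl.
- by move=> A SA [g h] gh; apply: SA; exact: double_coset_sym.
- move=> A SA; exists (double_coset S); first exact: subset_refl.
  by move=> [g h] [k /= gk kh]; apply: SA; exact: double_coset_trans gk kh.
Qed.

(** If E contains D o D with D a left and a right entourage, going from g to u g
uses the right one, and going from u g to u g v uses the left one. *)
Lemma entourage_double_coset (E : set (G * G)) : roelcke_entourage E ->
  exists2 S, finite_set S & double_coset S `<=` E.
Proof.
move=> [U [[_ _ _ sU] [lU rU] UE]]; have [D UD DE] := sU _ UE.
have [A /Aut_nbhsP[S fS SA] DA] := lU _ UD.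
have [B /Aut_nbhsP[T fT TB] DB] := rU _ UD.
exists (S `|` T); first by rewrite finite_setU.
move=> [g h] [u STu /= gh]; apply: DE; exists (u * g)%g.
  apply: DB; apply: TB => x Tx; rewrite [(g, _).1]/= invgM mulgA mulgV mul1g.
  by apply: stabilizerV Tx; move=> y Ty; apply: STu; right.
apply: DA; apply: SA => x Sx.
have hx : h x = (u * g)%g x by rewrite -gh//; left.
exact: etrans (congr1 (u * g)^-1%g hx) (AutVK _ x).
Qed.

(** Were there infinitely many double cosets, the complements of finite unions
of them would generate a filter on G. At a cluster point of its image in the
completion two elements of G come close together, although the second was chosen
outside the double coset of the first. *)
Lemma precompact_double_cosets S : roelcke_precompact G -> finite_set S ->
  exists r : seq G, forall h, exists2 x, x \in r & double_coset S (x, h).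
Proof.
move=> [X [i [[_ _ entE] cX]]] fS; apply: contrapT => nr.
have : @entourage (roelcke G) (double_coset S) by exact: double_coset_entourage.
rewrite entE => -[V entV VS].
pose Fi := filter_from [set: seq G]
  (fun r => [set h | forall x, x \in r -> ~ double_coset S (x, h)]).
have FF : ProperFilter Fi.
  apply: filter_from_proper; last first.
    move=> r _; apply: contrapT => nh; apply: nr; exists r => h.
    apply: contrapT => nx; apply: nh; exists h => x xr xh; apply: nx.
    by exists x.
  apply: filter_from_filter; first by exists nil.
  move=> s t _ _; exists (s ++ t) => // h hst.
  by split=> x xs; apply: hst; rewrite mem_cat xs ?orbT.
have [z [_ clz]] := cX (i @ Fi) _ (@filterT _ Fi _).
have [W entW WV] := entourage_split_ex entV.
have nz : nbhs z [set y | (W `&` W^-1%relation) (z, y)].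
  apply/nbhsP; exists (W `&` W^-1)%relation.
    by apply: filterI => //; exact: entourage_inv.
  by move=> y /xsectionP.
have FiI (r : seq G) :
    (i @ Fi) (i @` [set h | forall x, x \in r -> ~ double_coset S (x, h)]).
  by exists r => // h hr; exists h.
have [_ [[g _ <-] [_ Wg]]] := clz _ _ (FiI nil) nz.
have [_ [[h gh <-] [Wh _]]] := clz _ _ (FiI [:: g]) nz.
apply: (gh g); first exact: mem_head.
by apply: VS; apply: WV; exists z.
Qed.
End DoubleCosets.

(** * Finite structures inside an ultrahomogeneous structure *)

Local Notation incl := Defs.incl.

Section Structures.
Context (L : language).
Implicit Types (A B C D Z : structure L).

Lemma embedding_factor D D' E (u : embedding D E) (v : embedding D' E) :
  range u `<=` range v ->
  exists c : embedding D D', forall x, v (c x) = u x.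
Proof.
move=> uv.
have vP x : exists y, v y = u x.
  by have [y _ ?] := uv (u x) (imageT u x); exists y.
have [c cP] := choice vP.
have ci : injective c by move=> x y /(congr1 v); rewrite !cP; exact: emb_inj.
have cr (r : L) (t : 'I_(arity r) -> D) : interp r (c \o t) <-> interp r t.
  rewrite -(emb_interp u t) -(emb_interp v (c \o t)) compA.
  by rewrite (_ : v \o c = u) //; exact/funext.
by exists (Embedding ci cr).
Qed.

Lemma isomorphism_of_range D D' E (u : embedding D E) (v : embedding D' E) :
  range u = range v -> exists c : isomorphism D D', forall x, v (c x) = u x.
Proof.
move=> uv; have [|c cP] := @embedding_factor _ _ _ u v; first by rewrite uv.
suff cs y : exists x, c x = y by exists (Isomorphism cs).
have : range u (v y) by rewrite uv; exact: imageT.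
by move=> [x _ ux]; exists x; apply: (@emb_inj _ _ _ v); rewrite cP.
Qed.

Lemma range_incl A (S : set A) (S0 : S !=set0) : range (incl S0) = S.
Proof.
apply/seteqP; split=> [_ [x _ <-]|x Sx]; first exact: set_mem (valP x).
by exists (SigSub (mem_set Sx)).
Qed.

Lemma finite_embedding A B (f : embedding A B) :
  finite_set (range f) -> finite_set [set: A].
Proof.
have /inj_card_eq/eq_finite_set -> // : {in [set: A] &, injective f}.
by move=> x y _ _; exact: emb_inj.
Qed.

Lemma finite_induced A (S : set A) (S0 : S !=set0) :
  finite_set S -> finite_set [set: induced S0].
Proof.
by move=> fS; apply: (@finite_embedding _ _ (incl S0)); rewrite range_incl.
Qed.

Lemma ageP F B :
  age F B <-> finite_set [set: B] /\ exists _ : embedding B F, True.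
Proof.
split=> [[S [S0 [fS [c _]]]]|[fB [e _]]].
  split; last by exists (emb_comp (incl S0) c).
  apply: (@finite_embedding _ _ (iso_emb c)).
  apply: sub_finite_set (finite_induced S0 fS).
  exact: subsetT.
exists (range e), (range_neq0 e); split; first exact: finite_image.
have [|c _] := @isomorphism_of_range _ _ _ e (incl (range_neq0 e)).
  by rewrite range_incl.
by exists c.
Qed.

(** Ultrahomogeneity restated for two embeddings of an abstract finite
structure. *)
Lemma ultrahomogeneous_extension F B (e e' : embedding B F) :
  ultrahomogeneous F -> finite_set [set: B] ->
  exists g : Aut F, forall x, g (e x) = e' x.
Proof.
move=> uF fB.
have [c cP] := isomorphism_of_range (esym (range_incl (range_neq0 e))).
have [c' cP'] := isomorphism_of_range (esym (range_incl (range_neq0 e'))).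
have [g gP] := uF _ _ (range_neq0 e) (range_neq0 e') (finite_image e fB)
  (finite_image e' fB) (iso_comp c' (iso_inv c)).
by exists g => x; rewrite -cP gP -cP'; congr (incl _ (c' _)); exact: iso_funK.
Qed.

Lemma joint_iso_refl A Z (j : joint_embedding A Z) : joint_iso j j.
Proof. by exists (iso_id _). Qed.

Lemma joint_iso_sym A Z (j j' : joint_embedding A Z) :
  joint_iso j j' -> joint_iso j' j.
Proof.
move=> [c [cl cr]]; exists (iso_inv c).
by split=> x /=; [rewrite cl|rewrite cr]; rewrite /= iso_funK.
Qed.

Lemma joint_iso_trans A Z (j1 j2 j3 : joint_embedding A Z) :
  joint_iso j1 j2 -> joint_iso j2 j3 -> joint_iso j1 j3.
Proof.
move=> [c [cl cr]] [d [dl dr]]; exists (iso_comp d c).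
by split=> x /=; [rewrite dl|rewrite dr]; rewrite /= ?cl ?cr.
Qed.

Lemma eq_pattern A Z (j j' : joint_embedding A Z) :
  pattern j = pattern j' <-> joint_iso j j'.
Proof.
split=> [jj'|jj'].
  by have : pattern j' j' := joint_iso_refl j'; rewrite -jj'.
apply/seteqP; split=> k; first exact/joint_iso_trans/joint_iso_sym.
exact: joint_iso_trans.
Qed.

(** An isomorphism between the two common ranges is a finite partial isomorphism
of F, hence extends to an automorphism; conversely an automorphism that matches
the generators maps one common range onto the other. *)
Lemma joint_iso_spanP F A Z C (e : embedding C F) (a a' : embedding A C)
    (z z' : embedding Z C) :
  ultrahomogeneous F -> finite_set [set: A] -> finite_set [set: Z] ->
  joint_iso (joint_span a z) (joint_span a' z') <->
  exists g : Aut F, (forall x, g (e (a x)) = e (a' x)) /\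
                    (forall x, g (e (z x)) = e (z' x)).
Proof.
move=> uF fA fZ; split=> [[c [ca cz]]|[g [ga gz]]].
  pose s := incl (span_neq0 a z); pose s' := incl (span_neq0 a' z').
  have [|g gP] := @ultrahomogeneous_extension _ _ (emb_comp e s)
    (emb_comp e (emb_comp s' c)) uF.
    by apply: finite_induced; rewrite finite_setU; split; exact: finite_image.
  exists g; split=> x.
    by rewrite -[RHS]/(e (s' (joint_l (joint_span a' z') x))) ca;
      exact: (gP (joint_l (joint_span a z) x)).
  by rewrite -[RHS]/(e (s' (joint_r (joint_span a' z') x))) cz;
    exact: (gP (joint_r (joint_span a z) x)).
pose s := incl (span_neq0 a z); pose s' := incl (span_neq0 a' z').
pose u := emb_comp g (emb_comp e s); pose v := emb_comp e s'.
have uv : range u = range v.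
  apply/seteqP; split=> _ [[x xs] _ <-].
    case: (set_mem xs) => -[y _ xy]; rewrite /u /= /incl_fun/= -xy ?ga ?gz.
    - by exists (joint_l (joint_span a' z') y).
    - by exists (joint_r (joint_span a' z') y).
  case: (set_mem xs) => -[y _ xy]; rewrite /v /= /incl_fun/= -xy -?ga -?gz.
  - by exists (joint_l (joint_span a z) y).
  - by exists (joint_r (joint_span a z) y).
have [c cP] := isomorphism_of_range uv.
by exists c; split=> x /=; apply/esym/(@emb_inj _ _ _ v); rewrite cP /=;
  [exact: ga|exact: gz].
Qed.

End Structures.

(** * The definable Ramsey property and synchronization *)

Section Ramsey.
Context (L : language) (F : structure L).
Local Notation G := (Aut F).

(** The pointwise stabilizer V of P has finitely many left cosets g V with g P
inside Q. It is what makes the set of copies of one finite structure in another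
one finite. *)
Lemma finite_restrictions (P Q : set F) : finite_set P -> finite_set Q ->
  exists K : seq G, forall g : G, (forall x, P x -> Q (g x)) ->
    exists2 k, k \in K & forall x, P x -> k x = g x.
Proof.
move=> /(@finite_seqP {classic F})[p ->] /(@finite_seqP {classic F})[q ->].
elim: p => [|x p [K KP]].
  by exists [:: 1%g] => g _; exists 1%g; rewrite ?mem_head.
pose Ext (k : G) (y : F) (g : G) :=
  (forall z : {classic F}, z \in p -> g z = k z) /\ g x = y.
pose ext (k : G) (y : {classic F}) : G :=
  if pselect (exists g, Ext k y g) is left ex then sval (cid ex) else 1%g.
have extP k y g : Ext k y g -> Ext k y (ext k y).
  move=> kyg; rewrite /ext; case: pselect => [ex|[]]; first by case: cid.
  by exists g.
exists [seq ext k y | k <- K, y <- (q : seq {classic F})] => g gq.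
have [z zp|k kK kg] := KP g; first by apply: gq; rewrite /= inE zp orbT.
have [|kz kx] := extP k (g x) g; first by split=> // z zp; rewrite kg.
exists (ext k (g x)).
  by apply: (allpairs_f ext) => //; apply: gq; exact: mem_head.
by move=> z; rewrite /= inE => /predU1P[->//|zp]; rewrite kz// kg.
Qed.

(** The Ramsey property is used with A = Z = S and with B the union of S and of
the g^-1 S, g in D, so that each g^-1 restricted to S is an embedding of A into
B. For h in G, the restriction of h to S plays the part of z. A good copy of B
in C is given by some k, and [k^-1] is the element that synchronizes h. *)
Lemma definable_ramsey_synchronizing (S : set F) : ultrahomogeneous F ->
  definable_ramsey (age F) -> finite_set S -> synchronizing (double_coset S).
Proof.
(* Structures are non-empty, so a point is added to S if necessary. *)
move=> uF ramsey; wlog S0 : S / S !=set0.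
  move=> H fS D; have [x0 _] := carrier_neq0 F.
  have [||K KP] := H (S `|` [set x0]) _ _ D.
  - by exists x0; right.
  - by rewrite finite_setU; split=> //; exact: finite_set1.
  exists K => h; have [k kK kP] := KP h; exists k => // g g' gD g'D.
  by apply: double_cosetS (kP g g' gD g'D) => x; left.
move=> fS D.
pose P := S `|` \bigcup_(g in [set` D]) ((g^-1)%g @` S).
have fP : finite_set P.
  rewrite finite_setU; split=> //; apply: bigcup_finite => // g _.
  exact: finite_image.
have P0 : P !=set0 by have [x Sx] := S0; exists x; left.
have ageI (T : set F) (T0 : T !=set0) : finite_set T -> age F (induced T0).
  by move=> fT; exists T, T0; split=> //; exists (iso_id _).
have [C /ageP[fC [e _]] CP] :=
  ramsey _ _ _ (ageI S S0 fS) (ageI P P0 fP) (ageI S S0 fS).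
have [K KP] := finite_restrictions fP (finite_image e fC).
exists [seq k^-1%g | k <- K] => h.
pose z := emb_comp h (incl S0).
have [|b bP] := CP (joint_span e z).
  exists (Defs.span e z); last by exists (iso_id _).
  apply: ageI; rewrite finite_setU; split; first exact: finite_image.
  by apply: finite_image; exact: finite_induced.
have [k0 k0P] := ultrahomogeneous_extension (incl P0) (emb_comp e b) uF
  (finite_induced P0 fP).
have k0b (x : F) : P x -> exists y, k0 x = e (b y).
  by move=> Px; exists (SigSub (mem_set Px)); rewrite -[RHS]k0P.
have [x Px|k kK kP] := KP k0.
  by have [y ->] := k0b x Px; exact: imageT.
exists k^-1%g => [|g g' gD g'D]; first exact: map_f.
pose v := emb_comp e (incl (range_neq0 b)).
have copy (f : G) : f \in D -> exists a : embedding (induced S0) (emb_image b),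
    forall x, v (a x) = k ((f^-1)%g (incl S0 x)).
  move=> fD; pose u := emb_comp k (emb_comp (f^-1)%g (incl S0)).
  have [_ [x _ <-]|a aP] := @embedding_factor _ _ _ _ u v; last by exists a.
  have Px : P ((f^-1)%g (incl S0 x)).
    right; exists f => //; exists (incl S0 x) => //; exact: set_mem (valP x).
  have [y yP] := k0b _ Px; rewrite /u /= kP// yP.
  by exists (SigSub (mem_set (imageT b y))).
have [a aP] := copy g gD; have [a' a'P] := copy g' g'D.
have fA := finite_induced S0 fS.
have /eq_pattern/(joint_iso_spanP (incl (span_neq0 e z)) _ _ _ _ uF fA fA) :=
  bP a a'.
move=> [u [ua uz]].
have {}ua x : S x -> u (k ((g^-1)%g x)) = k ((g'^-1)%g x).
  move=> Sx; have := ua (SigSub (mem_set Sx)).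
  have := aP (SigSub (mem_set Sx)); have := a'P (SigSub (mem_set Sx)).
  by move=> /= -> ->.
have {}uz x : S x -> u (h x) = h x.
  by move=> Sx; exact: uz (SigSub (mem_set Sx)).
(* u fixes h S and moves k g^-1 to k g'^-1 on S; conjugation by k and
   translation by g and g' turn it into an element of the stabilizer of S. *)
exists (g' * k^-1 * u * k * g^-1)%g => x Sx.
  rewrite -[LHS]/(g' ((k^-1)%g (u (k ((g^-1)%g x))))) ua//.
  by rewrite AutVK AutKV.
rewrite -[LHS]/(g' ((k^-1)%g (u (k ((g^-1)%g (g ((k^-1)%g (h x)))))))).
by rewrite AutVK AutKV uz.
Qed.

(** Synchronization is applied to the union S of A and Z and to the inverses
of representatives of the embeddings of A into B; C contains the sets k^-1 B, k
in K. Up to an automorphism w, a joint embedding of C and Z is the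
inclusion of C together with the restriction to Z of some h, and the k provided
for h makes k^-1 B the required copy of B. *)
Lemma synchronizing_definable_ramsey : ultrahomogeneous F ->
  (forall S : set F, finite_set S -> synchronizing (double_coset S)) ->
  definable_ramsey (age F).
Proof.
move=> uF sync A B Z /ageP[fA [al _]] /ageP[fB [be _]] /ageP[fZ [ze _]].
have [M MP] := finite_restrictions (finite_image al fA) (finite_image be fB).
pose S := range al `|` range ze.
have fS : finite_set S by rewrite finite_setU; split; exact: finite_image.
have [K KP] := sync S fS [seq m^-1%g | m <- M].
pose T := range be `|` \bigcup_(k in [set` K]) ((k^-1)%g @` range be).
have fT : finite_set T.
  rewrite finite_setU; split; first exact: finite_image.
  by apply: bigcup_finite => // k _; do 2 apply: finite_image.
have T0 : T !=set0 by have [y yB] := range_neq0 be; exists y; left.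
have fC := finite_induced T0 fT.
exists (induced T0); first by apply/ageP; split=> //; exists (incl T0).
move=> j [E /ageP[_ [d _]] [jE _]].
pose de := emb_comp d jE.
have [w wP] := ultrahomogeneous_extension (incl T0) (emb_comp de (joint_l j))
  uF fC.
have [h hP] := ultrahomogeneous_extension ze
  (emb_comp (w^-1)%g (emb_comp de (joint_r j))) uF fZ.
have [k kK kP] := KP h.
have [|b bP] := @embedding_factor _ _ _ _ (emb_comp (k^-1)%g be) (incl T0).
  rewrite range_incl => _ [y _ <-]; right; exists k => //.
  by exists (be y) => //; exact: imageT.
exists b => a a'; apply/eq_pattern/(joint_iso_spanP de _ _ _ _ uF fA fZ).
have copy (c : embedding A (emb_image b)) : exists2 m, m \in M &
    forall x, m (al x) = k (incl T0 (incl (range_neq0 b) (c x))).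
  pose c' := emb_comp k (emb_comp (incl T0) (emb_comp (incl (range_neq0 b)) c)).
  have [g gP] := ultrahomogeneous_extension al c' uF fA.
  have [_ [x _ <-]|m mM mg] := MP g.
    rewrite gP; have [y _ yx] := set_mem (valP (c x)).
    exists y => //.
    rewrite -[RHS]/(k (incl T0 (incl (range_neq0 b) (c x)))).
    rewrite -[incl (range_neq0 b) (c x)]yx bP.
    by apply/esym; exact: AutKV.
  by exists m => // x; rewrite mg ?gP.
have [m mM ma] := copy a; have [m' m'M ma'] := copy a'.
have [v vS vh] := kP _ _ (map_f (fun m : G => m^-1%g) mM)
  (map_f (fun m : G => m^-1%g) m'M).
(* v witnesses that m^-1 k h and m'^-1 k h are in the same double coset; the
   conjugating factors move it to the range of the joint embedding. *)
exists (w * k^-1 * m' * v * m^-1 * k * w^-1)%g; split=> x.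
- rewrite -[LHS]/(w ((k^-1)%g (m' (v ((m^-1)%g (k ((w^-1)%g
    (de (joint_l j (incl (range_neq0 b) (a x))))))))))).
  rewrite -[de _]wP AutVK -ma AutVK vS; last by left; exact: imageT.
  rewrite ma' AutVK; exact: wP.
- rewrite -[LHS]/(w ((k^-1)%g (m' (v ((m^-1)%g (k ((w^-1)%g
    (de (joint_r j x))))))))).
  have -> : (w^-1)%g (de (joint_r j x)) = h (ze x) by rewrite hP.
  have Sz : S (ze x) by right; exact: imageT.
  have := vh _ Sz; rewrite -[v _]/(v ((m^-1)%g (k (h (ze x))))) => ->.
  rewrite -[LHS]/(w ((k^-1)%g (m' ((m'^-1)%g (k (h (ze x))))))).
  by rewrite AutKV AutVK hP; exact: AutKV.
Qed.

End Ramsey.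

Theorem theorem5 (R : realType) (L : language) (F : structure L)
    (F_fraisse : fraisse F) (AutF_rp : roelcke_precompact (Aut F)) :
  (forall Y : set (gelfand R (Aut F)),
     minimal_subflow (@gelfand_act R (Aut F)) Y ->
     exists phi : gelfand R (Aut F), Y = [set phi])
  <-> definable_ramsey (age F).
Proof.
have [_ uF] := F_fraisse; split=> [trivial_minimal|ramsey].
  apply: synchronizing_definable_ramsey => // S fS.
  have [r rP] := precompact_double_cosets AutF_rp fS.
  apply: (@trivial_minimal_synchronizing R _ _ r) rP => //.
  - exact: double_coset_entourage.
  - exact: double_coset_sym.
  - exact: double_coset_trans.
apply: synchronizing_trivial_minimal => E /entourage_double_coset[S fS SE] D.
have [K KP] := definable_ramsey_synchronizing uF ramsey fS D.
exists K => h; have [k kK kP] := KP h; exists k => // g g' gD g'D.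
exact/SE/kP.
Qed.
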